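(* Let $(X,\mu)$ be a standard probability space and let $G$ be a Polish group with ample generics. Then the Polish group $\mathrm L^0(X,\mu,G)$ has ample generics.
   Context: A probability space is standard if it is isomorphic to $[0,1]$ with Lebesgue measure. A Polish group $G$ has ample generics if for every $n\in\mathbb N$, the diagonal conjugacy action of $G$ on $G^n$, given by $g\cdot(g_1,\dots,g_n)=(gg_1g^{-1},\dots,gg_ng^{-1})$, has a comeager orbit (comeager: containing a dense countable intersection of open sets). For a Polish space $Y$, $\mathrm L^0(X,\mu,Y)$ is the set of Lebesgue-measurable maps $X\to Y$ up to equality $\mu$-almost everywhere, with the topology of convergence in measure: fixing a compatible metric $d_Y$ on $Y$, it is the topology generated by the sets $V_\epsilon(f)=\{g\in \mathrm L^0(X,\mu,Y):\mu(\{x\in X: d_Y(f(x),g(x))<\epsilon\})>1-\epsilon\}$ for $\epsilon>0$ and $f\in \mathrm L^0(X,\mu,Y)$. It is a Polish topology independent of the choice of $d_Y$. If $G$ is a Polish group, $\mathrm L^0(X,\mu,G)$ is a Polish group for pointwise multiplication. *)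

(* Defs.v *)
From HB Require Import structures.
From mathcomp Require Import all_boot all_order all_algebra.
From mathcomp Require Import all_classical all_reals all_analysis.
From mathcomp Require Import generic_quotient measurable_realfun borel_hierarchy.

Set Implicit Arguments.
Unset Strict Implicit.
Unset Printing Implicit Defensive.

Import Order.TTheory GRing.Theory Num.Theory.
Import numFieldNormedType.Exports.

Local Open Scope classical_set_scope.
Local Open Scope ring_scope.

Definition separable (T : topologicalType) : Prop :=
  exists2 D : set T, countable D & dense D.

Definition is_distance (R : realType) (T : Type) (d : T -> T -> R) : Prop :=
  [/\ forall x y, 0 <= d x y, forall x y, d x y = 0 <-> x = y,
      forall x y, d x y = d y x & forall x y z, d x z <= d x y + d y z].

Definition compatible_distance (R : realType) (T : topologicalType)
    (d : T -> T -> R) : Prop :=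
  forall (x : T) (A : set T),
    nbhs x A <-> exists2 e : R, 0 < e & [set y | d x y < e] `<=` A.

Definition complete_distance (R : realType) (T : topologicalType)
    (d : T -> T -> R) : Prop :=
  forall u : nat -> T,
    (forall e : R, 0 < e ->
      exists N, forall m n, (N <= m)%N -> (N <= n)%N -> d (u m) (u n) < e) ->
    exists l : T, u @ \oo --> l.

Definition completely_metrizable (R : realType) (T : topologicalType) : Prop :=
  exists d : T -> T -> R,
    [/\ is_distance d, compatible_distance d & complete_distance d].

Definition polish (R : realType) (T : topologicalType) : Prop :=
  separable T /\ completely_metrizable R T.

(* A group and a topology on the same carrier, without compatibility axioms:
   conjugacy orbits and their comeagerness only involve these data. *)
#[short(type="groupTopologicalType")]
HB.structure Definition GroupTopological :=
  {G of Topological G & monoid.Group G}.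

HB.mixin Record isPolishGroup (R : realType) G
    of Metric R G & monoid.Group G := {
  mulg_continuous : continuous (fun p : G * G => (p.1 * p.2)%g) ;
  invg_continuous : continuous (fun x : G => (x^-1)%g) ;
  polish_subproof : polish R G
}.

(* The distance mdist carried by the metric structure is an arbitrary distance
   inducing the topology; it need not be the complete one whose existence is
   required by polish, and no invariance is assumed. *)
#[short(type="polishGroupType")]
HB.structure Definition PolishGroup (R : realType) :=
  {G of Metric R G & monoid.Group G & isPolishGroup R G}.

Definition comeager (T : topologicalType) (A : set T) : Prop :=
  exists S : set T, [/\ Gdelta S, dense S & S `<=` A].

Definition diag_conj_orbit (G : groupTopologicalType) (n : nat)
    (x : {ptws 'I_n -> G}) : set {ptws 'I_n -> G} :=
  [set y | exists g : G, forall i, y i = (g * x i * g^-1)%g].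

(* {ptws 'I_n -> G} is G^n with the product topology. *)
Definition ample_generics (G : groupTopologicalType) : Prop :=
  forall n : nat, exists x : {ptws 'I_n -> G}, comeager (diag_conj_orbit x).

(* The completion of (T, mu): the sigma-algebra of the sets A `|` N with A
   measurable and N negligible, on which the outer measure of mu is a measure
   extending mu. *)
Section completion.
Context d (T : measurableType d) (R : realType).
Variable mu : {measure set T -> \bar R}.

Definition completion : Type := g_sigma_algebraType (completed_algebra_gen mu).

HB.instance Definition _ :=
  Measurable.copy completion (g_sigma_algebraType (completed_algebra_gen mu)).

Definition completed_measure (A : set completion) : \bar R := (mu^*)%mu A.

Lemma completion_caratheodory (A : set T) :
  measurable (A : set completion) -> (mu^*)%mu.-cara.-measurable A.
Proof.
apply: smallest_sub => //.
  split=> [|B|F]; rewrite ?setTD; first exact: measurable0.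
    exact: measurableC.
  exact: bigcupT_measurable.
move=> _ [B mB [N [C [mC C0 NC]]] <-].
have cara (U : set T) : d.-measurable U -> (mu^*)%mu.-cara.-measurable U.
  by move=> mU; apply: sub_caratheodory; exact: sub_sigma_algebra.
apply: measurableU; first exact: cara.
apply: measure_is_complete_caratheodory; exists C; split => //.
  exact: cara.
by rewrite -[RHS]C0; exact: measurable_mu_extE.
Qed.

Let completed_measure0 : completed_measure set0 = 0%E.
Proof. exact: outer_measure0. Qed.

Let completed_measure_ge0 A : (0 <= completed_measure A)%E.
Proof. exact: outer_measure_ge0. Qed.

Let completed_measure_sigma_additive : semi_sigma_additive completed_measure.
Proof.
move=> F mF tF mUF; apply: caratheodory_measure_sigma_additive => //.
  by move=> i; exact: completion_caratheodory.
exact: completion_caratheodory.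
Qed.

HB.instance Definition _ := isMeasure.Build _ _ _ completed_measure
  completed_measure0 completed_measure_ge0 completed_measure_sigma_additive.

Lemma completed_measureE (A : set T) :
  measurable A -> completed_measure A = mu A.
Proof. exact: measurable_mu_extE. Qed.

End completion.
Arguments completed_measure {d T R} mu A.

(* Isomorphism modulo null sets with [0,1] and its Lebesgue-measurable sets.
   Passing to the completion of X makes the notion insensitive to whether X
   comes with a Borel or with a Lebesgue-type sigma-algebra. *)
Definition standard_probability d (X : measurableType d) (R : realType)
    (mu : probability X R) : Prop :=
  exists (X0 : set X) (I0 : set R) (phi : X -> R),
    [/\ mu.-negligible (~` X0),
        I0 `<=` `[0, 1]%classic
          /\ (@lebesgue_measure R).-negligible (`[0, 1]%classic `\` I0),
        set_bij X0 I0 phi &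
        forall A : set X, A `<=` X0 ->
          (measurable (A : set (completion mu)) <->
           measurable (phi @` A : set (completion (@lebesgue_measure R))))
          /\ (measurable (A : set (completion mu)) ->
              completed_measure mu A =
              completed_measure (@lebesgue_measure R) (phi @` A))].

Section borel.
Context (R : realType) (G : polishGroupType R).

Definition borel_carrier : Type := G.
HB.instance Definition _ := Choice.on borel_carrier.
HB.instance Definition _ := isPointed.Build borel_carrier (1%g : G).

Definition borel : Type :=
  g_sigma_algebraType (@open G : set (set borel_carrier)).
HB.instance Definition _ := Measurable.copy borel
  (g_sigma_algebraType (@open G : set (set borel_carrier))).

Lemma open_borel (U : set G) : open U -> measurable (U : set borel).
Proof. by move=> oU; exact: sub_sigma_algebra. Qed.

Lemma measurable_fun_borel d (X : measurableType d) (f : X -> borel) :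
  (forall U : set G, open U -> measurable (f @^-1` U)) ->
  measurable_fun setT f.
Proof.
move=> mf; apply: (@measurability _ _ _ _ _ _ (@open G : set (set borel))) => //.
by move=> _ [U oU <-]; rewrite setTI; exact: mf.
Qed.

Lemma dense_sequence :
  exists s : nat -> G, forall (x : G) (e : R), 0 < e -> exists i, ball x e (s i).
Proof.
have [[D cD dD] _] := @polish_subproof R G.
have dDx (x : G) (e : R) : 0 < e -> exists2 y, D y & ball x e y.
  move=> e0; have [||y [xy Dy]] := dD (ball x e)^°.
  - by exists x; exact: nbhsx_ballx.
  - exact: open_interior.
  - by exists y => //; exact: interior_subset.
have [a Da _] := dDx 1%g 1 ltr01.
have /pfcard_geP[D0|[f]] := cD; first by move: Da; rewrite D0.
exists f => x e e0; have [y Dy xy] := dDx x e e0.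
by have [n _ fn] := 'surj_f Dy; exists n; rewrite fn.
Qed.

Lemma measurable_mulg d (X : measurableType d) (f g : X -> borel) :
  measurable_fun setT f -> measurable_fun setT g ->
  measurable_fun setT (fun x => ((f x : G) * (g x : G))%g : borel).
Proof.
move=> mf mg; apply: measurable_fun_borel => U oU.
have [s sP] := dense_sequence.
pose r k : R := k.+1%:R^-1.
pose B i k : set G := (ball (s i) (r k))^°.
have r0 k : 0 < r k by rewrite invr_gt0 ltr0n.
have mB i k (h : X -> borel) :
    measurable_fun setT h -> measurable (h @^-1` (B i k)).
  move=> mh; rewrite -[_ @^-1` _]setTI.
  by apply: mh => //; apply: open_borel; exact: open_interior.
pose P i j k := forall a b : G, B i k a -> B j k b -> U (a * b)%g.
pose F i j k := if `[< P i j k >] then f @^-1` (B i k) `&` g @^-1` (B j k)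
                else set0.
rewrite [_ @^-1` U](_ : _ = \bigcup_i \bigcup_j \bigcup_k F i j k).
  apply: bigcupT_measurable => i; apply: bigcupT_measurable => j.
  apply: bigcupT_measurable => k; rewrite /F; case: ifPn => // _.
  by apply: measurableI; exact: mB.
apply/seteqP; split=> [x /= Ux|x [i _ [j _ [k _]]]]; last first.
  by rewrite /F; case: asboolP => // Pijk [/= Bf Bg]; exact: Pijk.
have /(@mulg_continuous R G (f x, g x)) : nbhs (f x * g x : G)%g U.
  exact: open_nbhs_nbhs.
case=> -[/= V W] [/nbhs_ballP[e /= e0 eV] /nbhs_ballP[e' /= e'0 eW]] VW.
have [k [ke ke']] : exists k, r k + r k <= e /\ r k + r k <= e'.
  have m0 : 0 < Num.min e e' / 2 by rewrite divr_gt0// lt_min e0.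
  have [k rk] : exists k, r k < Num.min e e' / 2.
    by near \oo => k; exists k; near: k; exact: near_infty_natSinv_lt (PosNum m0).
  have : r k + r k <= Num.min e e' by rewrite [leRHS]splitr lerD// ltW.
  by rewrite le_min => /andP[? ?]; exists k.
have near_s (y : G) : exists i, B i k y /\ B i k `<=` ball y (r k + r k).
  have [i yi] := sP y (r k / 2) (divr_gt0 (r0 k) (ltr0Sn R 1)).
  have yi' : ball y (r k) (s i) by apply: le_ball yi; rewrite ler_piMr ?invf_le1 ?ler1n ?ltW.
  exists i; split; last first.
    by move=> z /interior_subset; exact: ball_triangle.
  apply/nbhs_ballP; exists (r k / 2) => /=; first by rewrite divr_gt0.
  by move=> z yz; rewrite [r k]splitr; apply: ball_triangle yz; exact: ball_sym.
have [i [Bi iV]] := near_s (f x); have [j [Bj jW]] := near_s (g x).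
exists i => //; exists j => //; exists k => //.
rewrite /F; case: asboolP => // -[] a b Ba Bb.
apply: (VW (a, b)); split => /=.
  by apply: eV; apply: (le_ball ke); exact: iV.
by apply: eW; apply: (le_ball ke'); exact: jW.
Unshelve. all: by end_near. Qed.

Lemma measurable_invg d (X : measurableType d) (f : X -> borel) :
  measurable_fun setT f ->
  measurable_fun setT (fun x => (f x : G)^-1%g : borel).
Proof.
move=> mf; apply: measurable_fun_borel => U oU.
rewrite -[_ @^-1` U]setTI.
apply: (mf measurableT ((fun y : G => y^-1%g) @^-1` U)); apply: open_borel.
by apply: open_comp => // y _; exact: invg_continuous.
Qed.

End borel.

(* L^0(X, mu, G): maps measurable from the completion of (X, mu) to the Borel
   sets of G, modulo almost everywhere equality. *)
Section L0.
Context d (X : measurableType d) (R : realType).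
Variables (mu : {measure set X -> \bar R}) (G : polishGroupType R).
Local Open Scope quotient_scope.

Definition L0 : Type := {mfun_ (completed_measure mu), completion mu >-> borel G}.

HB.instance Definition _ := EqQuotient.on L0.
HB.instance Definition _ := Choice.on L0.

Definition L0_fun (f : L0) : X -> G := repr f.

Definition L0_class (f : X -> G)
    (mf : measurable_fun setT (f : completion mu -> borel G)) : L0 :=
  \pi_L0 (mfun_Sub (mem_set mf)).

Lemma L0_measurable (f : L0) :
  measurable_fun setT (L0_fun f : completion mu -> borel G).
Proof. exact: measurable_funPT. Qed.

Local Notation ae := (almost_everywhere (completed_measure mu)).

Let ae_filter : Filter ae.
Proof. exact: ae_filter_ringOfSetsType. Qed.
#[local] Existing Instance ae_filter.

Let aeI A B : ae A -> ae B -> ae (A `&` B).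
Proof. exact: filterI. Qed.

Let aeS2 A B C : (forall x, A x -> B x -> C x) -> ae A -> ae B -> ae C.
Proof. exact: filterS2. Qed.

Lemma L0_eqP (f g : L0) : f = g <-> ae [set x | L0_fun f x = L0_fun g x].
Proof.
split=> [->|fg]; first exact: aeW.
rewrite -[f]reprK -[g]reprK; apply/eqP/ae_eqP.
by apply: filterS fg => x fgx _.
Qed.

Lemma L0_classE (f : X -> G)
    (mf : measurable_fun setT (f : completion mu -> borel G)) :
  ae [set x | L0_fun (L0_class mf) x = f x].
Proof.
have /eqP := reprK (L0_class mf).
rewrite [X in _ == X]/L0_class eqmodE => /asboolP.
by apply: filterS => x /(_ I).
Qed.

Definition L0_one : L0 := L0_class (measurable_cst (1%g : borel G)).

Definition L0_mul (f g : L0) : L0 :=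
  L0_class (measurable_mulg (L0_measurable f) (L0_measurable g)).

Definition L0_inv (f : L0) : L0 := L0_class (measurable_invg (L0_measurable f)).

Lemma L0_oneE : ae [set x | L0_fun L0_one x = 1%g].
Proof. exact: L0_classE. Qed.

Lemma L0_mulE f g :
  ae [set x | L0_fun (L0_mul f g) x = (L0_fun f x * L0_fun g x)%g].
Proof. exact: L0_classE. Qed.

Lemma L0_invE f : ae [set x | L0_fun (L0_inv f) x = (L0_fun f x)^-1%g].
Proof. exact: L0_classE. Qed.

Lemma L0_mulA : associative L0_mul.
Proof.
move=> f g h; apply/L0_eqP.
have := aeI (L0_mulE f (L0_mul g h)) (L0_mulE g h).
have := aeI (L0_mulE (L0_mul f g) h) (L0_mulE f g).
by apply: aeS2 => x [/= -> ->] [/= -> ->]; rewrite mulgA.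
Qed.

Lemma L0_mul1g : left_id L0_one L0_mul.
Proof.
move=> f; apply/L0_eqP; have := L0_mulE L0_one f; have := L0_oneE.
by apply: aeS2 => x /= + -> => ->; rewrite mul1g.
Qed.

Lemma L0_mulg1 : right_id L0_one L0_mul.
Proof.
move=> f; apply/L0_eqP; have := L0_mulE f L0_one; have := L0_oneE.
by apply: aeS2 => x /= + -> => ->; rewrite mulg1.
Qed.

Lemma L0_mulVg : left_inverse L0_one L0_inv L0_mul.
Proof.
move=> f; apply/L0_eqP; have := L0_mulE (L0_inv f) f.
have := aeI (L0_invE f) L0_oneE.
by apply: aeS2 => x [/= + ->] -> => ->; rewrite mulVg.
Qed.

Lemma L0_mulgV : right_inverse L0_one L0_inv L0_mul.
Proof.
move=> f; apply/L0_eqP; have := L0_mulE f (L0_inv f).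
have := aeI (L0_invE f) L0_oneE.
by apply: aeS2 => x [/= + ->] -> => ->; rewrite mulgV.
Qed.

HB.instance Definition _ :=
  monoid.isGroup.Build L0 L0_mulA L0_mul1g L0_mulg1 L0_mulVg L0_mulgV.

(* The basic sets V_e(f) of the topology of convergence in measure. *)
Definition L0_ball (e : R) (f : L0) : set L0 :=
  [set g | (1 - e)%:E <
    completed_measure mu [set x | (mdist (L0_fun f x) (L0_fun g x) < e)%R]]%E.

Definition L0_subbase : set (set L0) :=
  [set V | exists (e : R) (f : L0), 0 < e /\ V = L0_ball e f].

HB.instance Definition _ := isSubBaseTopological.Build L0 L0_subbase id.

End L0.

(* Main.v *)
(* Put Y = G^n and let a : G -> Y be the orbit map of a point with comeager
   orbit. It is enough to find a dense G_delta set S in Y and a Borel map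
   sigma with a (sigma y) = y on S: the maps X -> Y with values almost
   everywhere in S form a dense G_delta subset of L^0(X, mu, G)^n, and
   composing such a map with sigma conjugates the constant map to it.

   The section comes from Baire category alone, without measurable selection
   theorems. Cover G by a tree of cells C_s (s a finite sequence of integers)
   of vanishing diameter, each C_s being the union of its children C_(m :: s),
   and let H s be the open set of points near which the image of C_s is
   nonmeager in every open set. H [::] = Y since the orbit is comeager, and
   the union of the H (m :: s) is dense in H s, so a generic y follows a branch
   of the tree whose cells shrink to a point g. As y is in the closure of the
   image of each of these cells, a g = y. *)
From mathcomp Require Import finmap.
Require Import Defs.
From mathcomp Require Import all_boot all_order all_algebra.
From mathcomp Require Import all_classical all_reals all_analysis.
From mathcomp Require Import borel_hierarchy lra.

Set Implicit Arguments.
Unset Strict Implicit.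
Unset Printing Implicit Defensive.

Import Order.TTheory GRing.Theory Num.Theory.
Import numFieldNormedType.Exports.

Local Open Scope classical_set_scope.
Local Open Scope ring_scope.

Lemma inv_succ_lt (R : realType) (e : R) : 0 < e -> exists k, k.+1%:R^-1 < e.
Proof.
move=> e0; near \oo => k; exists k; near: k.
exact: near_infty_natSinv_lt (PosNum e0).
Unshelve. all: end_near. Qed.

(** * Baire category *)

Section category.
Context (T : topologicalType).
Implicit Types (A B : set T).

(** The complement contains a countable intersection of dense open sets. [Gdelta_dense] asks density
    of each open set, not of the intersection, so meager sets form a sigma-ideal in every space. *)
Definition meager A := exists2 S : set T, Gdelta_dense S & S `<=` ~` A.

Definition baire_space :=
  forall F : (set T)^nat, (forall i, open (F i) /\ dense (F i)) ->
  dense (\bigcap_i F i).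

Lemma Gdelta_dense_bigcap (I : countType) (F : I -> set T) :
  (forall i, open (F i) /\ dense (F i)) -> Gdelta_dense (\bigcap_i F i).
Proof.
(* Integers that code no index contribute the whole space. *)
move=> oF; exists (fun k => if @unpickle I k is Some i then F i else setT).
  move=> k; case: unpickle => [i|]; first exact: oF.
  by split; [exact: openT|move=> O O0 _; rewrite setIT].
apply/seteqP; split=> [x Fx k _|x Fx i _].
  by case: unpickle => // i; exact: Fx.
by have := Fx (pickle i) Logic.I; rewrite pickleK.
Qed.

Lemma meagerS A B : A `<=` B -> meager B -> meager A.
Proof.
move=> AB [S dS SB]; exists S => //.
by apply: subset_trans SB _; exact: subsetC.
Qed.

Lemma meager_bigcup (I : countType) (A : I -> set T) :
  (forall i, meager (A i)) -> meager (\bigcup_i A i).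
Proof.
move=> /(_ _)/cid2-/all_sig2[S]; rewrite /Gdelta_dense.
move=> /(_ _)/cid2-/all_sig2[F oF SF] SA.
exists (\bigcap_ij F ij.1 ij.2).
  by apply: Gdelta_dense_bigcap => -[i j]; exact: oF.
move=> x Fx [i _ Ax]; apply: (SA i x _ Ax); rewrite SF => j _.
exact: (Fx (i, j)).
Qed.

Lemma meager_complement_open_dense A : open A -> dense A -> meager (~` A).
Proof.
move=> oA dA; exists A; last by rewrite setCK.
by exists (fun=> A) => //; rewrite bigcap_const.
Qed.

Lemma meager0 : meager set0.
Proof.
rewrite -setCT; apply: meager_complement_open_dense; first exact: openT.
by move=> O O0 _; rewrite setIT.
Qed.

Lemma comeager_meagerC A : comeager A -> meager (~` A).
Proof.
move=> [S [[F oF SF] dS SA]]; exists S; last by rewrite setCK.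
exists F => // i; split=> // O O0 oO.
have [x [Ox Sx]] := dS O O0 oO; exists x; split => //.
by move: Sx; rewrite SF => /(_ i I).
Qed.

Lemma meagerU A B : meager A -> meager B -> meager (A `|` B).
Proof.
move=> mA mB.
apply: (@meagerS _ (\bigcup_(b : bool) if b then A else B)).
  by move=> x [Ax|Bx]; [exists true|exists false].
by apply: meager_bigcup => -[].
Qed.

(** An open set disjoint from [A] lies in the exterior of [A]. Hence adding this exterior turns
    density inside [A] into density in the whole space. *)
Lemma open_dense_compl_closure A B :
  open B -> (forall O, open O -> O `&` A !=set0 -> O `&` B !=set0) ->
  open (B `|` ~` closure A) /\ dense (B `|` ~` closure A).
Proof.
move=> oB AB; split.
  by apply: openU => //; apply: closed_openC; exact: closed_closure.
move=> O [x Ox] oO; have [OA|OA] := pselect (O `&` A !=set0).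
  by have [y [Oy By]] := AB _ oO OA; exists y; split => //; left.
exists x; split => //; right => /(_ O) [|y [Ay Oy]].
  exact: open_nbhs_nbhs.
by apply: OA; exists y.
Qed.

Lemma nonmeager_open A : baire_space -> open A -> A !=set0 -> ~ meager A.
Proof.
move=> bT oA A0 [_ [F oF ->] SA].
by have [x [Ax /SA]] := bT _ oF _ A0 oA.
Qed.

Definition heavy A : set T := [set y | exists U : set T,
  [/\ open U, U y &
    forall W, open W -> W `<=` U -> W !=set0 -> ~ meager (A `&` W)]].

Lemma open_heavy A : open (heavy A).
Proof.
rewrite openE => y -[U [oU Uy UA]]; rewrite /interior nbhsE; exists U; first by split.
by move=> z Uz; exists U; split.
Qed.

(** If a neighbourhood of [y] missed [A], the empty set would be nonmeager. *)
Lemma heavy_closure A : heavy A `<=` closure A.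
Proof.
move=> y [U [oU Uy UA]] N /nbhs_interior Ny.
have oNU : open (N° `&` U) by apply: openI => //; exact: open_interior.
have [AN0|] := eqVneq (A `&` (N° `&` U)) set0.
  have /(_ _ oNU) := UA; rewrite AN0 => UN.
  have NU0 : N° `&` U !=set0 by exists y; split => //; exact: nbhs_singleton.
  by have := UN (@subIsetr _ _ _) NU0 meager0.
by move/set0P => [z [Az [/interior_subset Nz _]]]; exists z.
Qed.

(* Banach's category theorem: in the union of the basic open sets where A is
   meager, A is still meager. *)
Lemma heavy_nonmeager A O (V : (set T)^nat) :
  (forall y N, nbhs y N -> exists k, [/\ open (V k), V k y & V k `<=` N]) ->
  open O -> ~ meager (A `&` O) -> heavy A `&` O !=set0.
Proof.
move=> bV oO nAO; apply: contrapT => /nonemptyPn AO0; apply: nAO.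
pose P k := open (V k) /\ meager (A `&` V k).
pose E := \bigcup_(k in P) V k.
have oE : open E by apply: bigcup_open => k [].
(* If some open [W] met [O] but not [E], then [A] would be nonmeager in every nonempty open subset
   of [W]&[O], whose points would be heavy. So [E] is dense in [O]. *)
have [oEO dEO] : open (E `|` ~` closure O) /\ dense (E `|` ~` closure O).
  apply: open_dense_compl_closure => // W oW [y [Wy Oy]].
  apply: contrapT => WE.
  suff : (heavy A `&` O) y by rewrite AO0.
  split => //; exists (W `&` O); split => //; first exact: openI.
  move=> W' oW' W'WO [z W'z] mAW'; apply: WE; exists z.
  have [k [oVk Vkz VkW']] : exists k, [/\ open (V k), V k z & V k `<=` W'].
    by apply: bV; exact: open_nbhs_nbhs.
  split; first by have [] := W'WO _ W'z.
  exists k => //; split => //.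
  by apply: meagerS mAW'; exact: setIS.
apply: (@meagerS _ (\bigcup_k (if `[< P k >] then A `&` V k else set0) `|`
                    ~` (E `|` ~` closure O))).
  move=> x [Ax Ox]; have [[k Pk Vkx]|Ex] := pselect (E x).
    by left; exists k => //; case: asboolP.
  by right => -[//|]; apply; exact: subset_closure.
apply: meagerU; last exact: meager_complement_open_dense.
apply: meager_bigcup => k; case: asboolP => [[]//|_]; exact: meager0.
Qed.

End category.

(** * Compatible distances and the Baire category theorem *)

Section distance.
Context (R : realType) (T : topologicalType) (d : T -> T -> R).
Hypotheses (dist_d : is_distance d) (comp_d : compatible_distance d).

Lemma distance_triangle x y z : d x z <= d x y + d y z.
Proof. by have [] := dist_d. Qed.

Lemma distance_sym x y : d x y = d y x.
Proof. by have [] := dist_d. Qed.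

Lemma distancexx x : d x x = 0.
Proof. by have [_ d0 _ _] := dist_d; apply/d0. Qed.

Lemma nbhs_dist x e : 0 < e -> nbhs x [set y | d x y < e].
Proof. by move=> e0; apply/comp_d; exists e. Qed.

Lemma open_dist x e : open [set y | d x y < e].
Proof.
rewrite openE => y /= xy; apply/comp_d; exists (e - d x y); first by rewrite subr_gt0.
by move=> z /=; rewrite ltrBrDl; exact/le_lt_trans/distance_triangle.
Qed.

Lemma open_distC x e : open [set y | e < d x y].
Proof.
rewrite openE => y /= xy; apply/comp_d; exists (d x y - e); first by rewrite subr_gt0.
move=> z /=; rewrite ltrBrDl -ltrBrDr => /lt_le_trans; apply.
by rewrite lerBlDr [d y z]distance_sym distance_triangle.
Qed.

Lemma cvg_dist_le (u : nat -> T) l x e : u @ \oo --> l ->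
  (\forall k \near \oo, d x (u k) <= e) -> d x l <= e.
Proof.
move=> ul xu; rewrite leNgt; apply/negP => xl.
have : nbhs l [set y | e < d x y].
  by apply: open_nbhs_nbhs; split => //; exact: open_distC.
move=> /ul /(filterI xu) /filter_ex[k [/=]].
by rewrite leNgt => /negP.
Qed.

Lemma baire_complete_distance : complete_distance d -> baire_space T.
Proof.
move=> cd F oF O [x Ox] oO.
(* A pair is a ball given by its centre and radius. The closed ball [b] must fit into the open ball
   [a] and into [F n]. *)
pose P (n : nat) (a b : T * R) := [/\ 0 < b.2, b.2 <= n.+1%:R^-1 &
  [set y | d b.1 y <= b.2] `<=` [set y | d a.1 y < a.2] `&` F n].
have shrink (U : set T) n : open U -> U !=set0 -> exists b : T * R,
    [/\ 0 < b.2, b.2 <= n.+1%:R^-1 & [set y | d b.1 y <= b.2] `<=` U `&` F n].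
  move=> oU U0; have [z UFz] := (oF n).2 _ U0 oU.
  have /comp_d[e e0 eU] : nbhs z (U `&` F n).
    by apply: open_nbhs_nbhs; split => //; apply: openI => //; have [] := oF n.
  exists (z, Num.min (e / 2) n.+1%:R^-1); split => /=.
  - by rewrite lt_min divr_gt0 ?invr_gt0 ?ltr0n.
  - by rewrite ge_min lexx orbT.
  - move=> y /=; rewrite le_min => /andP[zy _]; apply: eU => /=; lra.
have /choice[f fP] (na : nat * (T * R)) : exists b, 0 < na.2.2 -> P na.1 na.2 b.
  have [a0|a0] := ltP 0 na.2.2; last by exists na.2.
  have [|b ?] := @shrink [set y | d na.2.1 y < na.2.2] na.1 (open_dist _ _).
    by exists na.2.1; rewrite /= distancexx.
  by exists b.
have [b0 [b00 b01 b0O]] := shrink O 0%N oO (ex_intro _ x Ox).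
(* The ball [b0] already lies in [O] and in [F 0], so the ball of rank [k.+1] has to deal with
   [F k.+1]. *)
pose fix ar n := if n is k.+1 then f (k.+1, ar k) else b0.
have ar0 n : 0 < (ar n).2.
  by elim: n => // n IH; have [] := fP (n.+1, ar n) IH.
have arP n : P n.+1 (ar n) (ar n.+1) by exact: (fP (n.+1, ar n) (ar0 n)).
have ar_sub n m : (n <= m)%N -> [set y | d (ar m).1 y <= (ar m).2] `<=`
    [set y | d (ar n).1 y <= (ar n).2].
  elim: m => [|m IH]; first by rewrite leqn0 => /eqP ->.
  rewrite leq_eqVlt => /orP[/eqP -> //|/IH]; apply: subset_trans.
  by have [_ _ s] := arP m; move=> y /s[/ltW].
have ar_dist n m : (n <= m)%N -> d (ar n).1 (ar m).1 <= (ar n).2.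
  by move=> nm; apply: (ar_sub _ _ nm); rewrite /= distancexx ltW.
have ar_small n : (ar n).2 <= n.+1%:R^-1.
  by case: n => [//|n]; have [] := arP n.
have [|l al] := cd (fun n => (ar n).1).
  move=> e e0.
  have [N Ne] := inv_succ_lt (divr_gt0 e0 (ltr0Sn _ 1)).
  exists N => m n Nm Nn; apply: le_lt_trans (distance_triangle _ (ar N).1 _) _.
  rewrite [e]splitr ltrD//; last first.
    exact: le_lt_trans (le_trans (ar_dist _ _ Nn) (ar_small N)) Ne.
  rewrite distance_sym.
  exact: le_lt_trans (le_trans (ar_dist _ _ Nm) (ar_small N)) Ne.
have alb n : d (ar n).1 l <= (ar n).2.
  by apply: cvg_dist_le al _; exists n => // m /=; exact: ar_dist.
exists l; split; first by have [] := b0O l (alb 0%N).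
move=> [_|n _]; first by have [] := b0O l (alb 0%N).
by have [_ _ /(_ l (alb n.+1))[]] := arP n.
Qed.

End distance.

(** * Finite powers with the product topology *)

Section finite_power.
Context (T : topologicalType) (n : nat).
Implicit Types (y : {ptws 'I_n -> T}) (A : set {ptws 'I_n -> T}).

Lemma nbhs_ptws_box y (N : 'I_n -> set T) :
  (forall i, nbhs (y i) (N i)) ->
  nbhs y [set z : {ptws 'I_n -> T} | forall i, N i (z i)].
Proof.
move=> yN.
apply: (@filter_forall _ _ (fun i (z : {ptws 'I_n -> T}) => N i (z i)) (nbhs y)) => i.
exact: (@proj_continuous _ (fun=> T) i y _ (yN i)).
Qed.

(** Stated for any monotone family [B] of basic neighbourhoods: it applies to the balls of a
    distance on [G], and to the sets [pr (far e f g) < e] in [L0], which are not introduced as balls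
    of a distance. *)
Lemma nbhs_ptwsP (R : realType) (B : R -> T -> set T) :
  (forall e e' x, e <= e' -> B e x `<=` B e' x) ->
  (forall x N, nbhs x N <-> exists2 e, 0 < e & B e x `<=` N) ->
  forall y A, nbhs y A <->
    exists2 e, 0 < e & [set z | forall i, B e (y i) (z i)] `<=` A.
Proof.
move=> B_mono nbhsB y A; split=> [|[e e0]]; last first.
  move=> eA; apply: (@filterS _ (nbhs y) _ _ _ eA).
  have yB i : nbhs (y i) (B e (y i)) by apply/nbhsB; exists e.
  exact: nbhs_ptws_box yB.
(* The product topology is a supremum of initial topologies, so convergence of the filter of boxes
   to [y] can be checked one coordinate at a time. *)
pose F : set_system {ptws 'I_n -> T} := filter_from [set e | 0 < e]
  (fun e => [set z | forall i, B e (y i) (z i)]).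
have FF : Filter F.
  apply: filter_from_filter; first by exists 1 => /=.
  move=> e e' /= e0 e'0; exists (Num.min e e'); first by rewrite /= lt_min e0.
  move=> z /= yz; split => i; apply: B_mono (yz i); by rewrite ge_min lexx ?orbT.
suff : F --> y by exact.
apply/cvg_sup => i N /=; rewrite (@nbhsE (initial_topology _)).
move=> [W [[V oV VW] Wy] WN]; rewrite nbhs_filterE.
have /nbhsB[e e0 eV] : nbhs (y i) V.
  by apply: open_nbhs_nbhs; split => //; move: Wy; rewrite -VW.
by exists e => // z /= yz; apply: WN; rewrite -VW; apply: eV; exact: yz.
Qed.

Context (R : realType) (d : T -> T -> R).
Hypotheses (dist_d : is_distance d) (comp_d : compatible_distance d).

Lemma nbhs_ptws_dist y A : nbhs y A <->
  exists2 e, 0 < e & [set z | forall i, d (y i) (z i) < e] `<=` A.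
Proof.
apply: (@nbhs_ptwsP R (fun e x => [set z | d x z < e])); last exact: comp_d.
by move=> e e' x ee' z /= /lt_le_trans; apply.
Qed.

Definition max_distance y z : R := \big[Num.max/0]_i d (y i) (z i).

Lemma max_distance_lt y z e : 0 < e ->
  (max_distance y z < e) = [forall i, d (y i) (z i) < e].
Proof.
move=> e0; apply/bigmax_ltP/forallP => [[_ yz] i|yz]; [exact: yz|].
by split => // i _; exact: yz.
Qed.

Lemma is_distance_max : is_distance max_distance.
Proof.
have [d0 d_eq ds dt] := dist_d.
have le_max y z i : d (y i) (z i) <= max_distance y z by exact: le_bigmax.
have max0 y z : 0 <= max_distance y z by exact: bigmax_ge_id.
split => //.
- move=> y z; split=> [yz|->].
    apply/funext => i; apply/d_eq/eqP; rewrite eq_le d0 andbT.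
    by apply: le_trans (le_max y z i) _; rewrite yz.
  apply/eqP; rewrite eq_le max0 andbT; apply/bigmax_leP; split => // i _.
  by rewrite distancexx.
- by move=> y z; apply: eq_bigr => i _; exact: ds.
- move=> x y z; apply/bigmax_leP; split; first exact: addr_ge0.
  by move=> i _; apply: le_trans (dt _ (y i) _) _; exact: lerD.
Qed.

Lemma compatible_distance_max : compatible_distance max_distance.
Proof.
move=> y A; rewrite nbhs_ptws_dist.
by split=> -[e e0 eA]; exists e => // z /= yz; apply: eA => /=;
  [apply/forallP; rewrite -max_distance_lt|rewrite max_distance_lt//; apply/forallP].
Qed.

Lemma complete_distance_max : complete_distance d -> complete_distance max_distance.
Proof.
move=> cd u cu.
have cvg_coord (i : 'I_n) : exists l : T, (fun k => u k i) @ \oo --> l.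
  apply: cd => e e0; have [N NP] := cu e e0; exists N => k m Nk Nm.
  by apply: le_lt_trans (NP k m Nk Nm); exact: le_bigmax.
have [l ul] := choice cvg_coord.
exists l => A /nbhs_ptws_dist[e e0 eA].
have : \forall k \near \oo, forall i, d (l i) (u k i) < e.
  apply: filter_forall => i.
  exact: (ul i _ (nbhs_dist comp_d (l i) e0)).
by apply: filterS => k; exact: eA.
Qed.

(** Boxes whose sides are balls of a common radius [m.+1%:R^-1] centred on the dense sequence. The
    base is given by its sides, so that preimages can be computed coordinate by coordinate. *)
Lemma countable_base_ptws (s : nat -> T) :
  (forall x e, 0 < e -> exists k, d x (s k) < e) ->
  exists N : nat -> 'I_n -> set T, (forall k i, open (N k i)) /\
    forall y A, nbhs y A -> exists k,
      (forall i, N k i (y i)) /\ [set z | forall i, N k i (z i)] `<=` A.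
Proof.
move=> ds.
exists (fun k => if @unpickle ({ffun 'I_n -> nat} * nat)%type k is Some p
  then fun i => [set x | d (s (p.1 i)) x < p.2.+1%:R^-1] else fun=> set0).
split=> [k i|y A /nbhs_ptws_dist[e e0 eA]].
  by case: unpickle => [p|]; [exact: open_dist|exact: open0].
have [m me] := inv_succ_lt (divr_gt0 e0 (ltr0Sn _ 1)).
have m0 : 0 < m.+1%:R^-1 :> R by rewrite invr_gt0 ltr0n.
have /choice[f fP] (i : 'I_n) : exists k, d (y i) (s k) < m.+1%:R^-1 by exact: ds.
exists (pickle ([ffun i => f i], m)); rewrite pickleK /=; split=> [i|z /= yz].
  by rewrite ffunE distance_sym.
apply: eA => i /=; have := yz i; rewrite ffunE => szi.
have := distance_triangle dist_d (y i) (s (f i)) (z i); have := fP i.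
by move: m.+1%:R^-1 me szi => q; lra.
Qed.

End finite_power.

(** * A Borel section of a map with comeager range *)

Section borel_section.
Context (R : realType) (G Y : topologicalType).
Context (d : G -> G -> R) (dY : Y -> Y -> R) (p : nat -> G) (V : (set Y)^nat).
Context (a : G -> Y).
Hypotheses (dist_d : is_distance d) (comp_d : compatible_distance d).
Hypothesis complete_d : complete_distance d.
Hypothesis dense_p : forall x e, 0 < e -> exists k, d x (p k) < e.
Hypotheses (dist_dY : is_distance dY) (comp_dY : compatible_distance dY).
Hypothesis baire_Y : baire_space Y.
Hypothesis base_V :
  forall y N, nbhs y N -> exists k, [/\ open (V k), V k y & V k `<=` N].
Hypotheses (cont_a : continuous a) (comeager_a : comeager (range a)).

Fixpoint cell (s : seq nat) : set G :=
  if s is m :: s' then cell s' `&` [set x | d (p m) x < (size s').+1%:R^-1]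
  else setT.

Let H s := heavy (a @` cell s).

(* Since y \in H s always extends to some H (m :: s) at generic y, the least
   such m at each step defines a path depending on y in a Borel way. *)
Fixpoint leftmost (s : seq nat) : set Y :=
  if s is m :: s' then
    leftmost s' `&` (H s `\` \bigcup_(j in [set j | (j < m)%N]) H (j :: s'))
  else setT.

(** A point of [E s] lying in [H s] also lies in [H (m :: s)] for some [m]. The points common to all
    [E s] are the generic ones. *)
Let E s := \bigcup_m H (m :: s) `|` ~` closure (H s).

Lemma image_cell_sub s : a @` cell s `<=` \bigcup_m a @` cell (m :: s).
Proof.
move=> _ [x sx <-].
have r0 : 0 < (size s).+1%:R^-1 :> R by rewrite invr_gt0 ltr0n.
have [m xm] := dense_p x r0.
by exists m => //; exists x => //; split => //=; rewrite distance_sym.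
Qed.

(** Countably many images of children cover the image of [cell s]. Where the latter is nonmeager,
    one of them is nonmeager too, hence heavy at some point there. *)
Lemma open_dense_E s : open (E s) /\ dense (E s).
Proof.
apply: open_dense_compl_closure.
  by apply: bigcup_open => m _; exact: open_heavy.
move=> O oO [y [Oy [U [oU Uy UH]]]].
have oOU : open (O `&` U) by exact: openI.
have [m Hm] : exists m, ~ meager (a @` cell (m :: s) `&` (O `&` U)).
  apply: contrapT => /forallNP mm.
  have := UH _ oOU (@subIsetr _ _ _) (ex_intro _ y (conj Oy Uy)); apply.
  apply: (@meagerS _ _ (\bigcup_m (a @` cell (m :: s) `&` (O `&` U)))).
    by move=> z [/image_cell_sub[m _ sz] OUz]; exists m.
  by apply: meager_bigcup => m; apply: contrapT; exact: mm.
have [z [Hz [Oz _]]] := heavy_nonmeager base_V oOU Hm.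
by exists z; split => //; exists m.
Qed.

(** An open set is covered by its trace on the range and the meager complement of the range. Both
    being meager would contradict Baire's theorem. *)
Lemma H_nil : H [::] = setT.
Proof.
apply/seteqP; split => // y _; exists setT; split => //; first exact: openT.
move=> W oW _ W0 mW; apply: (nonmeager_open baire_Y oW W0).
apply: (meagerS _ (meagerU mW (comeager_meagerC comeager_a))) => z Wz.
by have [|] := pselect (range a z); [left|right].
Qed.

Lemma leftmost_H s : leftmost s `<=` H s.
Proof. by case: s => [|m s]; [rewrite H_nil|move=> y [_ []]]. Qed.

Lemma leftmost_next s y : (\bigcap_s E s) y -> leftmost s y ->
  exists m, leftmost (m :: s) y.
Proof.
move=> Sy sy; have [|/(_ (subset_closure (leftmost_H sy)))//] := Sy s Logic.I.
move=> [m0 _ m0y].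
have exm : exists m, `[< H (m :: s) y >] by exists m0; exact/asboolP.
case: (ex_minnP exm) => m /asboolP my m_min.
exists m; split => //; split => // -[j /= jm] /asboolP /m_min.
by rewrite leqNgt jm.
Qed.

(** Each step takes the least possible child, so [y] has at most one leftmost path. Properties of a
    chosen path therefore hold for every leftmost sequence. *)
Lemma leftmost_uniq s s' y : size s = size s' -> leftmost s y -> leftmost s' y ->
  s = s'.
Proof.
elim: s s' => [[]//|m s IH] [//|m' s'] [ss'] [sy [my mN]] [s'y [m'y m'N]].
have ? := IH _ ss' sy s'y; subst s'; congr (_ :: _).
have [mm|mm|//] := ltngtP m m'; first by exfalso; apply: m'N; exists m.
by exfalso; apply: mN; exists m'.
Qed.

Lemma leftmost_limit y : (\bigcap_s E s) y -> exists g, forall m s,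
  leftmost (m :: s) y -> d (p m) g <= (size s).+1%:R^-1.
Proof.
move=> Sy.
(* The implication is put under the quantifier so that choice gives a total function. Its value is
   irrelevant when [y] is not in [leftmost s]. *)
have next s : exists m, leftmost s y -> leftmost (m :: s) y.
  have [sy|sy] := pselect (leftmost s y); last by exists 0%N.
  by have [m] := leftmost_next Sy sy; exists m.
have [f fP] := choice next.
pose path n := iter n (fun s => f s :: s) [::].
have size_path n : size (path n) = n by elim: n => //= n ->.
have path_leftmost n : leftmost (path n) y by elim: n => //= n IH; exact: fP.
have path_nonempty n : exists x, cell (path n) x.
  have /heavy_closure/(_ setT)[|_ [[x xn _] _]] := leftmost_H (path_leftmost n).
    exact: filterT.
  by exists x.
have cell_path n m : (n <= m)%N -> cell (path m) `<=` cell (path n).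
  elim: m => [|m IH]; first by rewrite leqn0 => /eqP ->.
  rewrite leq_eqVlt => /orP[/eqP -> //|/IH]; apply: subset_trans.
  by move=> x [].
have [x xP] := choice path_nonempty.
have x_near n k : (n < k)%N -> d (p (f (path n))) (x k) < n.+1%:R^-1.
  by move=> nk; have [_ /=] := cell_path _ _ nk _ (xP k); rewrite size_path.
have [|g xg] := complete_d (u := x).
  move=> e e0; have [N Ne] := inv_succ_lt (divr_gt0 e0 (ltr0Sn _ 1)).
  exists N.+1 => m n Nm Nn.
  apply: le_lt_trans (distance_triangle dist_d _ (p (f (path N))) _) _.
  rewrite (distance_sym dist_d (x m)) [e]splitr ltrD//.
    by apply: lt_trans Ne; exact: x_near.
  by apply: lt_trans Ne; exact: x_near.
exists g => m s sy.
(* The given sequence is an initial piece of the constructed path. The strict bounds on [x k] become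
   a large inequality in the limit. *)
have := leftmost_uniq _ sy (path_leftmost (size s).+1).
rewrite size_path => /(_ erefl) [-> _].
apply: (cvg_dist_le dist_d comp_d xg).
by exists (size s).+1 => // k /= sk; exact/ltW/x_near.
Qed.

Lemma leftmost_size y n : (\bigcap_s E s) y -> exists m s,
  size s = n /\ leftmost (m :: s) y.
Proof.
move=> Sy; elim: n => [|n [m [s [sn sy]]]].
  by have [m my] := leftmost_next (s := [::]) Sy Logic.I; exists m, [::].
by have [m' my] := leftmost_next Sy sy; exists m', (m :: s); rewrite /= sn.
Qed.

(** As [y] is in the closure of the image of a small cell, some [x] in this cell has [a x] close to
    [y]. Both [x] and [g] are near the centre [p m], so [a x] is close to [a g] by continuity. *)
Lemma leftmost_limitE y g : (\bigcap_s E s) y ->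
  (forall m s, leftmost (m :: s) y -> d (p m) g <= (size s).+1%:R^-1) ->
  a g = y.
Proof.
move=> Sy yg; have [_ dY0 _ _] := dist_dY.
apply/dY0/eqP; rewrite eq_le; apply/andP; split; last by have [] := dist_dY.
apply/ler_addgt0Pl => e e0; rewrite addr0.
have e20 : 0 < e / 2 by rewrite divr_gt0.
have /comp_d[c c0 cP] := cont_a (nbhs_dist comp_dY (a g) e20).
have [n nc] := inv_succ_lt (divr_gt0 c0 (ltr0Sn _ 1)).
have [m [s [sn sy]]] := leftmost_size n Sy.
have [_ [[x [_ /= mx] <-] /= yx]] :=
  heavy_closure (leftmost_H sy) (nbhs_dist comp_dY y e20).
have gx : d g x < c.
  apply: le_lt_trans (distance_triangle dist_d _ (p m) _) _.
  have := yg _ _ sy; rewrite (distance_sym dist_d g); move: mx.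
  by rewrite sn; move: n.+1%:R^-1 nc => q; lra.
have := distance_triangle dist_dY (a g) (a x) y; have := cP _ gx => /=.
by rewrite (distance_sym dist_dY (a x)); lra.
Qed.

Lemma measurable_leftmost disp (X : measurableType disp) (f : X -> Y) s :
  (forall U, open U -> measurable (f @^-1` U)) -> measurable (f @^-1` leftmost s).
Proof.
move=> mf; elim: s => [|m s IH]; first exact: measurableT.
apply: measurableI => //; apply: measurableD; first exact/mf/open_heavy.
by apply/mf/bigcup_open => j _; exact: open_heavy.
Qed.

(** [Y] carries only a topology, so the Borel property of the section is expressed by pulling back
    along maps [f] from a measurable space. It is restricted to the generic set, the only place
    where [g] is controlled. *)
Lemma borel_section : exists (F : (set Y)^nat) (g : Y -> G),
  [/\ forall i, open (F i) /\ dense (F i),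
      forall y, (\bigcap_i F i) y -> a (g y) = y &
      forall disp (X : measurableType disp) (f : X -> Y),
        (forall U, open U -> measurable (f @^-1` U)) ->
        forall U, open U -> measurable (f @^-1` (\bigcap_i F i `&` g @^-1` U))].
Proof.
have [F oF FE] := Gdelta_dense_bigcap open_dense_E.
have limit y : exists g, (\bigcap_s E s) y -> forall m s,
    leftmost (m :: s) y -> d (p m) g <= (size s).+1%:R^-1.
  have [/leftmost_limit[g yg]|Sy] := pselect ((\bigcap_s E s) y); first by exists g.
  by exists (p 0%N).
have [g gP] := choice limit.
exists F, g; rewrite -FE; split=> // [y Sy|disp X f mf U oU].
  by apply: leftmost_limitE => //; exact: gP.
(* For generic [y], the point [g y] is in [U] exactly when [y] is in some [leftmost (m :: s)] whose
   closed ball around [p m] is contained in [U]. *)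
pose L ms := if `[< [set x | d (p ms.1) x <= (size ms.2).+1%:R^-1] `<=` U >]
  then leftmost (ms.1 :: ms.2) else set0.
rewrite (_ : _ `&` _ = \bigcap_i F i `&`
  \bigcup_k (if @unpickle (nat * seq nat)%type k is Some ms then L ms else set0)).
  rewrite preimage_setI preimage_bigcap preimage_bigcup; apply: measurableI.
    by apply: bigcapT_measurable => i; apply: mf; have [] := oF i.
  apply: bigcupT_measurable => k; case: unpickle => [[m s]|]; last first.
    by rewrite preimage_set0.
  rewrite /L; case: asboolP => _; first exact: measurable_leftmost.
  by rewrite preimage_set0.
rewrite -FE; apply/seteqP; split=> y [Sy]; last first.
  move=> [k _]; case: unpickle => // -[m s]; rewrite /L; case: asboolP => // mU my.
  by split => //; apply: mU; exact: gP.
move=> /= Ugy; split => //.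
have /comp_d[c c0 cU] : nbhs (g y) U by exact: open_nbhs_nbhs.
have [n nc] := inv_succ_lt (divr_gt0 c0 (ltr0Sn _ 1)).
have [m [s [sn sy]]] := leftmost_size n Sy.
exists (pickle (m, s)) => //; rewrite pickleK /L; case: asboolP => // -[] x /= mx.
apply: cU => /=; apply: le_lt_trans (distance_triangle dist_d _ (p m) _) _.
have := gP _ Sy _ _ sy; rewrite (distance_sym dist_d (g y)); move: mx.
by rewrite sn; move: n.+1%:R^-1 nc => q; lra.
Qed.

End borel_section.

(** * Convergence in measure *)

Section metric_distance.
Context (R : realType) (T : metricType R).

Lemma is_distance_mdist : is_distance (@mdist R T).
Proof.
split; [exact: mdist_ge0|split=> [|->]; [exact: mdist_positivity|exact: mdistxx]| |].
- exact: metric_sym.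
- exact: metric_triangle.
Qed.

Lemma compatible_distance_mdist : compatible_distance (@mdist R T).
Proof.
move=> x A; split=> [/nbhs_ballP[e /= e0 eA]|[e e0 eA]].
  by exists e => //; rewrite -ballEmdist.
by apply/nbhs_ballP; exists e => //=; rewrite ballEmdist.
Qed.

End metric_distance.

Section convergence_in_measure.
Context disp (X : measurableType disp) (R : realType) (mu : probability X R).
Context (G : polishGroupType R).
Local Notation Xc := (completion mu).
Local Notation nu := (completed_measure mu).
Local Notation dist := (@mdist R G).
Implicit Types (A B : set Xc) (f g h : L0 mu G).

Lemma completed_measureT : nu setT = 1%E.
Proof. by rewrite completed_measureE; [exact: probability_setT|exact: measurableT]. Qed.

Lemma completed_measure_fin A : measurable A -> nu A \is a fin_num.
Proof.
move=> mA; rewrite ge0_fin_numE//; apply: (@le_lt_trans _ _ (nu setT)).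
  by apply: le_measure; rewrite ?inE//; exact: measurableT.
by rewrite completed_measureT ltry.
Qed.

Definition pr A : R := fine (nu A).

Lemma prE A : measurable A -> nu A = (pr A)%:E.
Proof. by move=> mA; rewrite fineK// completed_measure_fin. Qed.

Lemma pr_ge0 A : 0 <= pr A.
Proof. exact: fine_ge0. Qed.

Lemma pr0 : pr set0 = 0.
Proof. by rewrite /pr measure0. Qed.

Lemma le_pr A B : measurable A -> measurable B -> A `<=` B -> pr A <= pr B.
Proof. by move=> mA mB AB; rewrite -lee_fin -!prE// le_measure ?inE. Qed.

Lemma prU A B : measurable A -> measurable B -> pr (A `|` B) <= pr A + pr B.
Proof.
move=> mA mB; rewrite -lee_fin EFinD -!prE//; last exact: measurableU.
exact: (@measureU2 _ Xc R (completed_measure mu)).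
Qed.

Lemma pr_bigcup_ord n (F : 'I_n -> set Xc) : (forall i, measurable (F i)) ->
  measurable (\bigcup_i F i) /\ pr (\bigcup_i F i) <= \sum_i pr (F i).
Proof.
elim: n F => [|n IH] F mF.
  rewrite big_ord0 (_ : \bigcup_i F i = set0) ?pr0//.
  by apply/seteqP; split => // x [[]].
have -> : \bigcup_i F i = F ord0 `|` \bigcup_i F (lift ord0 i).
  apply/seteqP; split => [x [i _]|x [Fx|[i _ Fx]]].
  - by case: (unliftP ord0 i) => [j ->|->]; [right; exists j|left].
  - by exists ord0.
  - by exists (lift ord0 i).
have [mU le_U] := IH _ (fun i => mF (lift ord0 i)).
split; first exact: measurableU.
rewrite big_ord_recl; apply: (le_trans (prU _ _)) => //; exact: lerD.
Qed.

Lemma prC A : measurable A -> pr (~` A) = 1 - pr A.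
Proof.
move=> mA; have mAC := measurableC mA.
have : nu (A `|` ~` A) = (nu A + nu (~` A))%E.
  by apply: (@measureU _ R Xc nu) => //; exact: setICr.
rewrite setUv completed_measureT !prE// -EFinD => -[->].
by rewrite addrAC subrr add0r.
Qed.

(** Continuity of a finite measure from above. *)
Lemma pr_bigcap_lt (F : (set Xc)^nat) c : (forall k, measurable (F k)) ->
  (forall k, F k.+1 `<=` F k) -> pr (\bigcap_k F k) < c ->
  exists k, pr (F k) < c.
Proof.
move=> mF niF; have mI : measurable (\bigcap_k F k) by exact: bigcapT_measurable.
rewrite -lte_fin -prE// => Fc.
have F0 : (nu (F 0%N) < +oo)%E by rewrite prE// ltry.
have cvgF : nu \o F @ \oo --> nu (\bigcap_k F k).
  apply: nonincreasing_cvg_mu => //.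
  by apply/nonincreasing_seqP => k; apply/subsetPset; exact: niF.
have cN : nbhs (nu (\bigcap_k F k)) [set y | (y < c%:E)%E].
  by apply: open_nbhs_nbhs; split => //; exact: open_ereal_lt_ereal.
have /filter_ex[k Fk] : \forall k \near \oo, (nu (F k) < c%:E)%E := cvgF _ cN.
by exists k; rewrite -lte_fin -prE.
Qed.

End convergence_in_measure.

(** * Neighbourhoods for convergence in measure *)

Section L0_topology.
Context disp (X : measurableType disp) (R : realType) (mu : probability X R).
Context (G : polishGroupType R).
Local Notation Xc := (completion mu).
Local Notation nu := (completed_measure mu).
Local Notation dist := (@mdist R G).
Implicit Types (f g h : L0 mu G) (e : R).

Lemma dist_triangle (x y z : G) : dist x z <= dist x y + dist y z.
Proof. exact: metric_triangle. Qed.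

Lemma dist_sym (x y : G) : dist x y = dist y x.
Proof. exact: metric_sym. Qed.

Lemma dist_dense_sequence : exists s : nat -> G,
  forall x r, 0 < r -> exists i, dist x (s i) < r.
Proof.
have [s sP] := dense_sequence G; exists s => x r r0.
by have [i] := sP x r r0; rewrite ballEmdist; exists i.
Qed.

Lemma measurable_preimage_open (u : X -> G) (U : set G) :
  measurable_fun setT (u : Xc -> borel G) -> open U ->
  measurable (u @^-1` U : set Xc).
Proof.
move=> mu_ oU; have := mu_ measurableT _ (open_borel oU); by rewrite setTI.
Qed.

Lemma measurable_mdist_lt (u v : X -> G) e :
  measurable_fun setT (u : Xc -> borel G) ->
  measurable_fun setT (v : Xc -> borel G) ->
  measurable ([set x | dist (u x) (v x) < e] : set Xc).
Proof.
move=> mu_ mv; have [s sP] := dist_dense_sequence.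
have openB x r : open [set y | dist x y < r].
  by apply: open_dist; [exact: is_distance_mdist|exact: compatible_distance_mdist].
(* By separability, [dist (u x) (v x) < e] is witnessed by a point of the dense sequence close to
   [u x]. This leaves a countable union of conditions on [u] and [v] separately. *)
rewrite (_ : [set x | _] = \bigcup_k \bigcup_i
    (u @^-1` [set y | dist (s i) y < k.+1%:R^-1] `&`
     v @^-1` [set y | dist (s i) y < e - k.+1%:R^-1])).
  apply: bigcupT_measurable => k; apply: bigcupT_measurable => i.
  by apply: measurableI; apply: measurable_preimage_open.
apply/seteqP; split=> [x /= uve|x [k _ [i _ [/= su sv]]]]; last first.
  have := dist_triangle (u x) (s i) (v x).
  by rewrite (dist_sym (u x) (s i)); move: k.+1%:R^-1 su sv => q; lra.
have e0 : 0 < (e - dist (u x) (v x)) / 2 by rewrite divr_gt0 ?subr_gt0.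
have [k ke] := inv_succ_lt e0.
have k0 : 0 < k.+1%:R^-1 :> R by rewrite invr_gt0 ltr0n.
have [i] := sP (u x) _ k0; rewrite dist_sym => sik.
exists k => //; exists i => //; split => //=.
have := dist_triangle (s i) (u x) (v x).
by move: k.+1%:R^-1 sik ke => q; lra.
Qed.

Definition far e f g : set Xc := [set x | e <= dist (L0_fun f x) (L0_fun g x)].

Lemma farC e f g : far e f g = ~` [set x | dist (L0_fun f x) (L0_fun g x) < e].
Proof. by apply/seteqP; split=> x; rewrite /far /= leNgt => /negP. Qed.

Lemma measurable_far e f g : measurable (far e f g).
Proof.
by rewrite farC; apply: measurableC; apply: measurable_mdist_lt; exact: L0_measurable.
Qed.

Lemma farxx e f : 0 < e -> far e f f = set0.
Proof.
by move=> e0; apply/seteqP; split => // x; rewrite /far /= mdistxx leNgt e0.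
Qed.

Lemma pr_far_triangle e e' f g h :
  pr (far (e + e') f h) <= pr (far e f g) + pr (far e' g h).
Proof.
apply: le_trans (prU (measurable_far e f g) (measurable_far e' g h)).
apply: le_pr; [exact: measurable_far|by apply: measurableU; exact: measurable_far|].
move=> x; rewrite /far /= => fh.
have := dist_triangle (L0_fun f x) (L0_fun g x) (L0_fun h x).
by have [|] := leP e (dist (L0_fun f x) (L0_fun g x)); [left|right => /=; lra].
Qed.

Lemma L0_ballE e f : L0_ball e f = [set g | pr (far e f g) < e].
Proof.
have mlt g : measurable ([set x | dist (L0_fun f x) (L0_fun g x) < e] : set Xc).
  by apply: measurable_mdist_lt; exact: L0_measurable.
apply/seteqP; split => g; rewrite /L0_ball /= farC prC// prE// lte_fin; lra.
Qed.

Lemma open_L0_ball e f : 0 < e -> open (L0_ball e f).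
Proof.
move=> e0; exists [set L0_ball e f]; last by rewrite bigcup_set1.
move=> _ ->; exists [fset L0_ball e f]%fset.
  by move=> V /fset1P ->; apply/mem_set; exists e, f.
by rewrite set_fset1 bigcap_set1.
Qed.

Lemma L0_ball_mono e e' f : e <= e' ->
  [set g | pr (far e f g) < e] `<=` [set g | pr (far e' f g) < e'].
Proof.
move=> ee' g /= fge; apply: lt_le_trans (ee'); apply: le_lt_trans fge.
apply: le_pr; [exact: measurable_far|exact: measurable_far|].
by move=> x; rewrite /far /=; apply: le_trans.
Qed.

(** [far e f g] is the decreasing intersection of the sets [far (e - k.+1%:R^-1) f g]. The slack
    obtained in the distance allows a ball to be recentred at one of its points. *)
Lemma pr_far_lt e f g : pr (far e f g) < e ->
  exists2 e', e' < e & pr (far e' f g) < e.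
Proof.
move=> fge.
have [|||k ke] := @pr_bigcap_lt _ _ _ mu (fun k => far (e - k.+1%:R^-1) f g) e.
- by move=> k; exact: measurable_far.
- move=> k x; rewrite /far /=; apply: le_trans; rewrite lerB// lef_pV2 ?posrE ?ltr0n//.
  by rewrite ler_nat.
- rewrite (_ : \bigcap_k _ = far e f g)//; apply/seteqP; split=> x.
    move=> xe; rewrite /far /= leNgt; apply/negP; rewrite -subr_gt0 => /inv_succ_lt[k].
    have := xe k Logic.I; rewrite /far /=.
    by move: k.+1%:R^-1 => q; lra.
  move=> xe k _; rewrite /far /=; apply: le_trans xe.
  by rewrite lerBlDr lerDl invr_ge0.
- by exists (e - k.+1%:R^-1) => //; rewrite ltrBlDr ltrDl invr_gt0 ltr0n.
Qed.

Lemma nbhs_L0P f A : nbhs f A <->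
  exists2 e, 0 < e & [set g | pr (far e f g) < e] `<=` A.
Proof.
split=> [|[e e0 eA]]; last first.
  apply: filterS eA _; rewrite -L0_ballE; apply: open_nbhs_nbhs; split.
    exact: open_L0_ball.
  by rewrite L0_ballE /= farxx// pr0.
pose F : set_system (L0 mu G) := filter_from [set e | 0 < e]
  (fun e => [set g | pr (far e f g) < e]).
have FF : Filter F.
  apply: filter_from_filter; first by exists 1 => /=.
  move=> e e' /= e0 e'0; exists (Num.min e e'); first by rewrite /= lt_min e0.
  by move=> g fg; split; apply: L0_ball_mono fg; rewrite ge_min lexx ?orbT.
rewrite nbhsE => -[W [[D DS <-] [V DV Vf]] WA].
suff FV : F V by apply: (filterS _ FV) => g Vg; apply: WA; exists V.
have [E ES EV] := DS _ DV; rewrite -EV; apply: filter_bigI => U EU.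
have /asboolP[e [h [e0 Uh]]] := ES _ EU.
have : U f by move: Vf; rewrite -EV; exact.
rewrite /= Uh L0_ballE => /pr_far_lt[e' e'e he'].
(* The first bound is the slack in the distance, the second the slack in the measure. They are
   combined by the triangle inequality with [e = e' + (e - e')]. *)
exists (Num.min (e - e') (e - pr (far e' h f))).
  by rewrite /= lt_min !subr_gt0 e'e.
move=> g /= fg.
have : pr (far (e - e') f g) < e - pr (far e' h f).
  apply: lt_le_trans (_ : Num.min (e - e') (e - pr (far e' h f)) <= _); last first.
    by rewrite ge_min lexx orbT.
  apply: le_lt_trans fg; apply: le_pr; [exact: measurable_far|exact: measurable_far|].
  by move=> x; rewrite /far /=; apply: le_trans; rewrite ge_min lexx.
rewrite ltrBrDl; apply: le_lt_trans.
by rewrite -[X in far X h g](subrKC e') pr_far_triangle.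
Qed.

End L0_topology.

(** * Comeager sets in the powers of L0 *)

Section ample.
Context disp (X : measurableType disp) (R : realType) (mu : probability X R).
Context (G : polishGroupType R) (n : nat).
Local Notation Xc := (completion mu).
Local Notation nu := (completed_measure mu).
Local Notation dist := (@mdist R G).
Local Notation Y := {ptws 'I_n -> G}.
Local Notation L0n := {ptws 'I_n -> L0 mu G}.
Implicit Types (F : L0n) (y z : Y).

Local Notation ae := (almost_everywhere nu).

Let ae_filter : Filter ae.
Proof. exact: ae_filter_ringOfSetsType. Qed.
#[local] Existing Instance ae_filter.

Lemma pr_eq0_ae (A : set Xc) : measurable A -> pr A = 0 <-> ae (~` A).
Proof.
move=> mA; split=> [A0|].
  by exists A; split => //; [rewrite prE// A0|rewrite setCK].
move=> [B [mB B0 AB]]; apply/eqP; rewrite eq_le pr_ge0 andbT.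
rewrite setCK in AB; apply: le_trans (le_pr mA mB AB) _.
by rewrite -lee_fin -prE// B0.
Qed.

Definition ev F (x : X) : Y := fun i => L0_fun (F i) x.

Lemma dist_base : exists N : nat -> 'I_n -> set G, (forall k i, open (N k i)) /\
  forall y A, nbhs y A -> exists k,
    (forall i, N k i (y i)) /\ [set z : Y | forall i, N k i (z i)] `<=` A.
Proof.
have [s sP] := dist_dense_sequence G.
exact: (@countable_base_ptws G n R dist (is_distance_mdist G)
  (@compatible_distance_mdist R G) s sP).
Qed.

Lemma open_box (N : 'I_n -> set G) : (forall i, open (N i)) ->
  open [set z : Y | forall i, N i (z i)].
Proof.
move=> oN; rewrite openE => z zN; apply: nbhs_ptws_box => i.
by apply: open_nbhs_nbhs; split => //; exact: zN.
Qed.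

Lemma measurable_power_open (u : X -> Y) (U : set Y) :
  (forall i, measurable_fun setT (u^~ i : Xc -> borel G)) ->
  open U -> measurable (u @^-1` U : set Xc).
Proof.
move=> mu_ oU; have [N [oN NP]] := dist_base.
rewrite (_ : _ @^-1` _ = \bigcup_k
  (if `[< [set z : Y | forall i, N k i (z i)] `<=` U >]
   then \bigcap_i (u^~ i @^-1` N k i) else set0)).
  apply: bigcupT_measurable => k; case: asboolP => // _.
  apply: fin_bigcap_measurable => // i _.
  exact: measurable_preimage_open.
apply/seteqP; split=> [x /= Ux|x [k _]].
  have [k [xk kU]] := NP _ _ (open_nbhs_nbhs (conj oU Ux)).
  by exists k => //; case: asboolP => // _ i _; exact: xk.
case: asboolP => // kU xk; apply: kU => i; exact: xk.
Qed.

Lemma measurable_ev F (U : set Y) : open U -> measurable (ev F @^-1` U : set Xc).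
Proof. by apply: measurable_power_open => i; exact: L0_measurable. Qed.

Lemma nbhs_L0_power F (A : set L0n) : nbhs F A <->
  exists2 e : R, 0 < e & [set F' | forall i, pr (far e (F i) (F' i)) < e] `<=` A.
Proof.
apply: (nbhs_ptwsP (B := fun e f => [set g | pr (far e f g) < e])).
- by move=> e e' f; exact: L0_ball_mono.
- exact: nbhs_L0P.
Qed.

(** The closed set [~] U[is the intersection of its open enlargements]K k[, so one of them still has
    a preimage under]ev F[of measure below]c[. If]F'[is close to]F[, then outside a small set]ev F'
    x[can be in]~[U] only if [ev F x] is in [K k]. *)
Lemma open_pr_lt (U : set Y) (c : R) : open U ->
  open [set F | pr (ev F @^-1` (~` U) : set Xc) < c].
Proof.
move=> oU; rewrite openE => F /= Fc; apply/nbhs_L0_power.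
pose r k : R := k.+1%:R^-1.
have r0 k : 0 < r k by rewrite invr_gt0 ltr0n.
pose K k : set Y := [set y | exists2 z, ~ U z & forall i, dist (z i) (y i) < r k].
have oK k : open (K k).
  rewrite (_ : K k = \bigcup_(z in ~` U) [set y : Y | forall i, dist (z i) (y i) < r k]).
    apply: bigcup_open => z _.
    apply: (@open_box (fun i => [set t | dist (z i) t < r k])) => i.
    exact: (open_dist (is_distance_mdist G) (@compatible_distance_mdist R G)).
  by apply/seteqP; split=> y [z Uz zy]; exists z.
have mK k : measurable (ev F @^-1` K k : set Xc) by exact: measurable_ev.
have mU F' : measurable (ev F' @^-1` (~` U) : set Xc).
  by rewrite preimage_setC; apply: measurableC; exact: measurable_ev.
have [||k Fk] := @pr_bigcap_lt _ _ _ mu (fun k => ev F @^-1` K k) c mK.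
- move=> k x [z Uz zx]; exists z => // i; apply: lt_le_trans (zx i) _.
  by rewrite lef_pV2 ?posrE ?ltr0n// ler_nat.
- rewrite (_ : \bigcap_k _ = ev F @^-1` (~` U))//; apply/seteqP; split=> x.
    move=> xK Ux; have : nbhs (ev F x) U by exact: open_nbhs_nbhs.
    move=> /(nbhs_ptws_dist (@compatible_distance_mdist R G))[e e0 eU].
    have [k ke] := inv_succ_lt e0; have [z Uz zx] := xK k Logic.I.
    by apply: Uz; apply: eU => i /=; rewrite dist_sym; apply: lt_trans ke; exact: zx.
  by move=> Ux k _; exists (ev F x) => // i; rewrite mdistxx.
(* The [n] exceptional sets have total measure at most [n] times [e]. Dividing the slack by [n.+1]
   makes the final inequality strict and covers [n = 0]. *)
pose e := Num.min (r k) ((c - pr (ev F @^-1` K k : set Xc)) / n.+1%:R).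
have e0 : 0 < e by rewrite lt_min r0 divr_gt0 ?subr_gt0 ?ltr0n.
exists e => // F' /= FF'.
have [mfar le_far] := pr_bigcup_ord (fun i => measurable_far e (F i) (F' i)).
have : pr (ev F' @^-1` (~` U) : set Xc) <=
    pr (ev F @^-1` K k : set Xc) + pr (\bigcup_i far e (F i) (F' i)).
  apply: le_trans (prU (mK k) mfar); apply: le_pr => //; first exact: measurableU.
  move=> x Ux.
  have [xF|xF] := pselect ((\bigcup_i far e (F i) (F' i)) x); [by right|left].
  exists (ev F' x) => // i; rewrite dist_sym ltNge; apply/negP => rF.
  apply: xF; exists i => //; rewrite /far /=; apply: le_trans rF.
  by rewrite ge_min lexx.
move=> /le_lt_trans; apply; rewrite -ltrBrDl; apply: (le_lt_trans le_far).
apply: (@le_lt_trans _ _ (\sum_(i < n) e)).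
  by apply: ler_sum => i _; exact/ltW/FF'.
rewrite sumr_const card_ord; apply: (@lt_le_trans _ _ (e *+ n.+1)).
  by rewrite mulrS ltrDr.
by rewrite -mulr_natr -ler_pdivlMr ?ltr0n// ge_min lexx orbT.
Qed.

(** Countably many points of [S] suffice to approximate all of [Y]. Replacing [ev F x] by the first
    of them within [e] gives a measurable map with values in [S], uniformly close to [ev F]. *)
Lemma dense_L0_valued_in (S : set Y) :
  dense S -> dense [set F | ae [set x | S (ev F x)]].
Proof.
move=> dS O [F OF] oO.
have /nbhs_L0_power[e e0 eO] : nbhs F O by exact: open_nbhs_nbhs.
have [N [oN NP]] := dist_base.
have [y0 [_ Sy0]] : setT `&` S !=set0 by apply: dS; [exists (fun=> 1%g)|exact: openT].
(* One point of [S] in each basic box that meets [S], and the default [y0] for the others. *)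
have pick k : exists y, S y /\
    (([set z : Y | forall i, N k i (z i)] `&` S) !=set0 -> forall i, N k i (y i)).
  have [[y [yN Sy]]|kS] := pselect (([set z : Y | forall i, N k i (z i)] `&` S) !=set0).
    by exists y.
  by exists y0.
have [s sP] := choice pick.
pose P k : set Y := [set y | forall i, dist (s k i) (y i) < e].
have oP k : open (P k).
  apply: (@open_box (fun i => [set t | dist (s k i) t < e])) => i.
  exact: (open_dist (is_distance_mdist G) (@compatible_distance_mdist R G)).
have exP y : exists k, `[< P k y >].
  have [|k [yN kP]] := NP y [set z | forall i, dist (z i) (y i) < e].
    apply/(nbhs_ptws_dist (@compatible_distance_mdist R G)).
    by exists e => // z yz i; rewrite dist_sym; exact: yz.
  exists k; apply/asboolP; apply: kP; apply: (sP k).2.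
  by apply: dS; [exists y|exact: open_box].
pose m x := ex_minn (exP (ev F x)).
have mP x : P (m x) (ev F x) by rewrite /m; case: ex_minnP => k /asboolP.
have mE k : [set x | m x = k] =
    ev F @^-1` P k `\` \bigcup_(j in [set j | (j < k)%N]) (ev F @^-1` P j).
  apply/seteqP; split=> x /=.
    move=> <-; split; first exact: mP.
    move=> [j /= jm /asboolP Pj]; move: jm; rewrite /m; case: ex_minnP => i _ /(_ j Pj).
    by rewrite leqNgt => /negP.
  move=> [/asboolP Pk nP]; rewrite /m; case: ex_minnP => i /asboolP Pi i_min.
  have := i_min _ Pk; rewrite leq_eqVlt => /orP[/eqP //|ik].
  by exfalso; apply: nP; exists i.
have mm k : measurable ([set x | m x = k] : set Xc).
  rewrite mE; apply: measurableD; first exact: measurable_ev.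
  by apply: bigcup_measurable => j _; exact: measurable_ev.
have mF' (i : 'I_n) : measurable_fun setT ((fun x => s (m x) i) : Xc -> borel G).
  apply: measurable_fun_borel => U oU.
  rewrite (_ : _ @^-1` _ = \bigcup_k
    if `[< U (s k i) >] then [set x | m x = k] else set0).
    by apply: bigcupT_measurable => k; case: asboolP.
  apply/seteqP; split=> [x /= Ux|x [k _]]; first by exists (m x) => //; case: asboolP.
  by case: asboolP => // Uk /= ->.
have F'E : ae [set x | forall i, L0_fun (L0_class (mF' i)) x = s (m x) i].
  apply: (@filter_forall _ _
    (fun i x => L0_fun (L0_class (mF' i)) x = s (m x) i) ae) => i.
  exact: L0_classE.
exists (fun i => L0_class (mF' i)); split; last first.
  apply: filterS F'E => x F'x /=.
  rewrite (_ : ev _ x = s (m x)); first exact: (sP _).1.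
  by apply/funext => i; exact: F'x.
apply: eO => i /=; rewrite (_ : pr _ = 0)//; apply/pr_eq0_ae.
  exact: measurable_far.
apply: filterS F'E => x /(_ i) F'x; rewrite /far /= F'x dist_sym.
by apply/negP; rewrite -ltNge; exact: mP.
Qed.

End ample.

(** * Generic tuples of maps and conjugacy in L0 *)

Section L0_conjugacy.
Context disp (X : measurableType disp) (R : realType) (mu : probability X R).
Context (G : polishGroupType R) (n : nat).
Local Notation Xc := (completion mu).
Local Notation Y := {ptws 'I_n -> G}.
Local Notation L0n := {ptws 'I_n -> L0 mu G}.
Local Notation ae := (almost_everywhere (completed_measure mu)).

Let ae_filter : Filter ae.
Proof. exact: ae_filter_ringOfSetsType. Qed.
#[local] Existing Instance ae_filter.

Lemma cvg_mulg (T : Type) (F : set_system T) {FF : Filter F}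
    (u v : T -> G) (g h : G) :
  u @ F --> g -> v @ F --> h -> (fun t => u t * v t)%g @ F --> (g * h)%g.
Proof.
move=> ug vh.
exact: (@continuous2_cvg _ _ _ _ F FF u v (fun a b : G => a * b)%g g h
  (@mulg_continuous R G (g, h)) ug vh).
Qed.

Lemma continuous_diag_conj (x : Y) :
  continuous (fun g : G => (fun i => (g * x i * g^-1)%g) : Y).
Proof.
move=> g A /(nbhs_ptws_dist (@compatible_distance_mdist R G))[e e0 eA].
have : \forall h \near g, forall i,
    mdist (g * x i * g^-1)%g (h * x i * h^-1)%g < e.
  apply: (@filter_forall _ _
    (fun i h => mdist (g * x i * g^-1)%g (h * x i * h^-1)%g < e) (nbhs g)) => i.
  have cvg_conj : (fun h : G => h * x i * h^-1)%g @ g --> (g * x i * g^-1)%g.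
    apply: cvg_mulg; last exact: invg_continuous.
    by apply: cvg_mulg; [exact: cvg_id|exact: cvg_cst].
  exact: cvg_conj _ (nbhs_dist (@compatible_distance_mdist R G) _ e0).
by apply: filterS => h gh; exact: eA.
Qed.

(** Being almost everywhere in all [U k] means that each exceptional set has measure below every
    [j.+1%:R^-1]. These are countably many open conditions by [open_pr_lt], and [dense_L0_valued_in]
    gives density. *)
Lemma comeager_L0_valued_in (U : (set Y)^nat) :
  (forall k, open (U k) /\ dense (U k)) -> dense (\bigcap_k U k) ->
  comeager [set F : L0n | ae [set t | (\bigcap_k U k) (ev F t)]].
Proof.
move=> oU dU.
pose W (kj : nat * nat) : set L0n :=
  [set F : L0n | pr (ev F @^-1` (~` U kj.1) : set Xc) < kj.2.+1%:R^-1].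
have mU k (F : L0n) : measurable (ev F @^-1` (~` U k) : set Xc).
  by rewrite preimage_setC; apply: measurableC; apply: measurable_ev; have [] := oU k.
have UW : [set F : L0n | ae [set t | (\bigcap_k U k) (ev F t)]]
    `<=` \bigcap_kj W kj.
  move=> F /= UF [k j] _; rewrite /W /= (_ : pr _ = 0) ?invr_gt0 ?ltr0n//.
  by apply/pr_eq0_ae => //; apply: filterS UF => t /(_ k Logic.I) Ut; exact.
have WU : \bigcap_kj W kj `<=`
    [set F : L0n | ae [set t | (\bigcap_k U k) (ev F t)]].
  move=> F WF; have : ae [set t | forall k, U k (ev F t)].
    apply: ae_foralln => k.
    have /pr_eq0_ae : pr (ev F @^-1` (~` U k) : set Xc) = 0.
      apply/eqP; rewrite eq_le pr_ge0 andbT leNgt; apply/negP => /inv_succ_lt[j].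
      by rewrite ltNge; apply/negP; rewrite negbK; exact/ltW/(WF (k, j)).
    move=> /(_ (mU k F)); apply: filterS => t; exact: contrapT.
  by apply: filterS => t Ut k _; exact: Ut.
have [V oV VE] : Gdelta_dense (\bigcap_kj W kj).
  apply: Gdelta_dense_bigcap => -[k j]; split.
    by apply: open_pr_lt; have [] := oU k.
  move=> O O0 oO.
  have [F [OF /UW/(_ (k, j) Logic.I) WF]] := dense_L0_valued_in dU O0 oO.
  by exists F.
exists (\bigcap_kj W kj); split => //.
  by exists V => // i; have [] := oV i.
move=> O O0 oO; have [F [OF /UW WF]] := dense_L0_valued_in dU O0 oO.
by exists F.
Qed.

(** Representatives of products, inverses and classes agree with the pointwise operations only
    almost everywhere. The proof intersects the finitely many full-measure sets involved. *)
Lemma L0_diag_conj_orbit (x : Y) (F : L0n) (g : X -> G)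
    (mx : forall i, measurable_fun setT ((fun=> x i) : Xc -> borel G))
    (mg : measurable_fun setT (g : Xc -> borel G)) :
  ae [set t | forall i, ev F t i = (g t * x i * (g t)^-1)%g] ->
  diag_conj_orbit (fun i => L0_class (mx i)) F.
Proof.
move=> Fg; exists (L0_class mg) => i; apply/L0_eqP.
have aeI A B : ae A -> ae B -> ae (A `&` B) by exact: filterI.
have xgE := aeI _ _ (L0_classE (mx i)) (L0_classE mg).
have mulE := aeI _ _ (L0_mulE (L0_class mg) (L0_class (mx i)))
  (L0_mulE (L0_class mg * L0_class (mx i))%g (L0_class mg)^-1%g).
have := aeI _ _ (aeI _ _ xgE (L0_invE (L0_class mg))) (aeI _ _ mulE Fg).
apply: filterS.
move=> t [[[/= xt gt] gVt] [[gxt gxgt] Ft]].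
by rewrite gxgt gxt gVt xt gt; exact: Ft.
Qed.

End L0_conjugacy.

Theorem theorem2 (R : realType) (d : measure_display) (X : measurableType d)
    (mu : probability X R) (G : polishGroupType R) :
  standard_probability mu -> ample_generics G -> ample_generics (L0 mu G).
Proof.
move=> _ ampleG n; have [x comeager_x] := ampleG n.
have [_ [dG [dist_dG comp_dG complete_dG]]] := @polish_subproof R G.
have [s sP] := dist_dense_sequence G.
(* Convergence in measure uses [mdist], while completeness is known for [dG]. Both induce the same
   topology, so density passes from one to the other. *)
have dense_s y e : 0 < e -> exists i, dG y (s i) < e.
  move=> /(nbhs_dist comp_dG y)/compatible_distance_mdist[r r0 ry].
  by have [i /ry] := sP y r r0; exists i.
have [N [oN NP]] := dist_base G n.
pose V k : set {ptws 'I_n -> G} := [set z | forall i, N k i (z i)].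
have base_V y A : nbhs y A -> exists k, [/\ open (V k), V k y & V k `<=` A].
  by move=> /NP[k [yk kA]]; exists k; split => //; exact: open_box.
have dist_dY := is_distance_max n dist_dG.
have comp_dY := @compatible_distance_max G n R dG comp_dG.
have baire_Y : baire_space {ptws 'I_n -> G}.
  apply: (baire_complete_distance dist_dY comp_dY).
  exact: complete_distance_max.
pose a (g : G) : {ptws 'I_n -> G} := fun i => (g * x i * g^-1)%g.
have comeager_a : comeager (range a).
  rewrite (_ : range a = diag_conj_orbit x)//; apply/seteqP; split=> y.
    by move=> [g _ <-]; exists g.
  by move=> [g yg]; exists g => //; apply/funext => i; rewrite yg.
have [U [sigma [oU sigmaP m_sigma]]] := borel_section dist_dG comp_dG complete_dG
  dense_s dist_dY comp_dY baire_Y base_V (@continuous_diag_conj R G n x) comeager_a.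
have mx i : measurable_fun setT ((fun=> x i) : completion mu -> borel G).
  exact: measurable_cst.
(* The generic tuple consists of the constant maps with values [x i]. *)
exists (fun i => L0_class (mx i)).
have [S [GS dS SU]] := comeager_L0_valued_in mu oU (baire_Y _ oU).
exists S; split => //; apply: (subset_trans SU) => F UF.
(* The conjugating map is the section applied to [ev F t]. The value [1] off the generic set is
   taken only on a null set and keeps [g] measurable. *)
pose g t := if `[< (\bigcap_k U k) (ev F t) >] then sigma (ev F t) else 1%g.
have mg : measurable_fun setT (g : completion mu -> borel G).
  apply: measurable_fun_borel => O oO.
  have mUF : measurable (ev F @^-1` (\bigcap_k U k) : set (completion mu)).
    rewrite preimage_bigcap; apply: bigcapT_measurable => k.
    by apply: measurable_ev; have [] := oU k.
  rewrite (_ : g @^-1` O = ev F @^-1` (\bigcap_k U k `&` sigma @^-1` O) `|`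
    (if `[< O 1%g >] then ~` (ev F @^-1` (\bigcap_k U k)) else set0)).
    apply: measurableU; last by case: asboolP => // _; exact: measurableC.
    by apply: m_sigma => // W; exact: measurable_ev.
  apply/seteqP; split=> t; rewrite /g /=; case: asboolP => Ut.
  - by left.
  - by move=> O1; right; case: asboolP.
  - by case=> [[]//|]; case: asboolP.
  - by case=> [[]//|]; case: asboolP.
apply: (L0_diag_conj_orbit mx mg).
apply: (@filterS _ _ (@ae_filter_ringOfSetsType _ _ _ _) _ _ _ UF) => t Ut i.
rewrite /g; case: asboolP => // _.
by have /(congr1 (@^~ i)) := sigmaP _ Ut.
Qed.
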